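(* Let $n\geq 3$. There exist two convex bodies $K,L\subset\mathbb{R}^n$ such that $K\neq L$ and $K\neq -L$, but nevertheless for every $\xi\in S^{n-1}$ there is an orthogonal transformation $\phi_\xi\in O(n-1)$ in $\xi^\perp$ satisfying $\phi_\xi(K|\xi^\perp)=L|\xi^\perp$.
   Context: A convex body in $\mathbb{R}^n$ is a compact set with non-empty interior such that the segment joining every pair of its points is contained in it. $S^{n-1}$ is the unit sphere of $\mathbb{R}^n$, and for $\xi\in S^{n-1}$, $\xi^\perp=\{x\in\mathbb{R}^n:\langle x,\xi\rangle=0\}$ is the hyperplane through the origin perpendicular to $\xi$. $K|\xi^\perp$ denotes the orthogonal projection of $K$ onto $\xi^\perp$. ''$\phi_\xi\in O(n-1)$ in $\xi^\perp$'' means that $\phi_\xi$ is a linear orthogonal transformation of the $(n-1)$-dimensional Euclidean space $\xi^\perp$ onto itself. $-L=\{-x:x\in L\}$. *)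

(* Defs.v *)
From HB Require Import structures.
From mathcomp Require Import all_boot all_order all_algebra.
From mathcomp Require Import all_classical all_reals all_analysis.

Set Implicit Arguments.
Unset Strict Implicit.
Unset Printing Implicit Defensive.

Import Order.TTheory GRing.Theory Num.Theory.
Import numFieldNormedType.Exports.

Local Open Scope classical_set_scope.
Local Open Scope ring_scope.

Section Euclidean.
Context {R : realType} {n : nat}.
Implicit Types (x y xi : 'rV[R]_n) (K : set 'rV[R]_n).

Definition dot x y : R := \sum_(i < n) x 0 i * y 0 i.

(* The library norm `|x| on 'rV[R]_n is the sup norm; it induces the same
   topology, but the unit sphere has to be taken for the Euclidean norm. *)
Definition euclidean_norm x : R := Num.sqrt (dot x x).

Definition unit_sphere : set 'rV[R]_n := [set x | euclidean_norm x = 1].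

Definition perp xi : set 'rV[R]_n := [set x | dot x xi = 0].

(* This is the orthogonal projection onto [perp xi] when xi is a unit vector. *)
Definition proj_perp xi x : 'rV[R]_n := x - dot x xi *: xi.

Definition convex_body K := [/\ compact K, convex_set K & interior K !=set0].

(* Every linear map of the subspace [perp xi] extends to the whole space, so an
   element of O(perp xi) is given by an ambient linear map of which only the
   restriction to [perp xi] matters. *)
Definition orthogonal_on_perp xi (phi : {linear 'rV[R]_n -> 'rV[R]_n}) :=
  phi @` perp xi = perp xi /\
  (forall x y, perp xi x -> perp xi y -> dot (phi x) (phi y) = dot x y).

End Euclidean.

(* Main.v *)
(* Let Q(x) = x_1^2 - x_0^2.  Starting from the ball of radius sqrt 2, raise the
   squared support function 2|x|^2 to 2|x|^2 + |Q(x)| on two of the four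
   half-cones cut out by Q <> 0: for K on {Q < 0, x_0 > 0} and
   {Q > 0, x_1 > 0}, for L on {Q < 0, x_0 > 0} and {Q > 0, x_1 < 0}.
   Both functions are support functions, since each bump is that of half an
   ellipsoid.  Given xi, let w maximise Q on the unit sphere of xi^perp.  The
   reflection in w preserves Q on xi^perp because w is an eigenvector of the
   restricted form, and by interlacing of eigenvalues it keeps the sign of x_0
   where Q < 0 and flips the sign of x_1 where Q > 0.  So it carries the support
   function of K|xi^perp to that of L|xi^perp, although no global +-1 does. *)

Require Import Defs.
From HB Require Import structures.
From mathcomp Require Import all_boot all_order all_algebra.
From mathcomp Require Import all_classical all_reals all_analysis.
From mathcomp Require Import ring lra.
Set Implicit Arguments.
Unset Strict Implicit.
Unset Printing Implicit Defensive.

Import Order.TTheory GRing.Theory Num.Theory.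
Import numFieldNormedType.Exports.
Local Open Scope classical_set_scope.
Local Open Scope ring_scope.

(** * The Euclidean inner product, and separation of a point from a compact convex set *)

Section InnerProduct.
Context {R : realType} {n : nat}.
Implicit Types (x y z w xi : 'rV[R]_n).

Lemma dotC x y : dot x y = dot y x.
Proof. by apply: eq_bigr => i _; rewrite mulrC. Qed.

Lemma dotDl x y z : dot (x + y) z = dot x z + dot y z.
Proof.
by rewrite -big_split; apply: eq_bigr => i _; rewrite mxE mulrDl.
Qed.

Lemma dotZl a x y : dot (a *: x) y = a * dot x y.
Proof. by rewrite mulr_sumr; apply: eq_bigr => i _; rewrite mxE mulrA. Qed.

Lemma dotNl x y : dot (- x) y = - dot x y.
Proof. by rewrite -scaleN1r dotZl mulN1r. Qed.

Lemma dotDr x y z : dot z (x + y) = dot z x + dot z y.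
Proof. by rewrite dotC dotDl !(dotC z). Qed.

Lemma dotZr a x y : dot x (a *: y) = a * dot x y.
Proof. by rewrite dotC dotZl dotC. Qed.

Lemma dotNr x y : dot x (- y) = - dot x y.
Proof. by rewrite dotC dotNl dotC. Qed.

Definition dotE := (dotDl, dotDr, dotNl, dotNr, dotZl, dotZr).

Lemma dot_delta x i : dot x (delta_mx 0 i) = x 0 i.
Proof.
rewrite /dot (bigD1 i)//= mxE !eqxx mulr1 big1 ?addr0// => j ji.
by rewrite mxE (negbTE ji) andbF mulr0.
Qed.

Lemma sqr_le_dot x i : x 0 i ^+ 2 <= dot x x.
Proof.
rewrite /dot (bigD1 i)//= -expr2 lerDl sumr_ge0// => j _.
by rewrite -expr2 sqr_ge0.
Qed.

Lemma dot_ge0 x : 0 <= dot x x.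
Proof. by apply: sumr_ge0 => j _; rewrite -expr2 sqr_ge0. Qed.

Lemma dot_eq0 x : (dot x x == 0) = (x == 0).
Proof.
apply/eqP/eqP => [x0|->]; last by rewrite /dot big1// => i _; rewrite mxE mul0r.
apply/rowP => i; rewrite mxE; apply/eqP; rewrite -sqrf_eq0 eq_le sqr_ge0 andbT.
by rewrite -x0 sqr_le_dot.
Qed.

Lemma unit_sphereP x : unit_sphere x <-> dot x x = 1.
Proof.
rewrite /unit_sphere/= /euclidean_norm; split=> [|->]; last exact: sqrtr1.
by move=> /(congr1 (fun r => r ^+ 2)); rewrite sqr_sqrtr ?dot_ge0// expr1n.
Qed.

Lemma dot_continuous (T : topologicalType) (f g : T -> 'rV[R]_n) :
  continuous f -> continuous g -> continuous (fun t => dot (f t) (g t)).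
Proof.
move=> cf cg; apply: continuous_big => [|i _ t]; first exact: add_continuous.
have cc (h : T -> 'rV[R]_n) : continuous h -> {for t, continuous (fun t => h t 0 i)}.
  move=> ch; apply: (@continuous_comp _ _ _ h (fun x : 'rV[R]_n => x 0 i)).
    exact: ch.
  exact: coord_continuous.
by apply: cvgM; apply: cc.
Qed.

Lemma dot_proj_perp xi x y : perp xi y -> dot (proj_perp xi x) y = dot x y.
Proof. by rewrite /perp/= /proj_perp !dotE (dotC xi) => ->; ring. Qed.

Lemma perp_proj_perp xi x : unit_sphere xi -> perp xi (proj_perp xi x).
Proof. by move=> /unit_sphereP h; rewrite /perp/= /proj_perp !dotE h; ring. Qed.

Lemma convex_setP (C : set 'rV[R]_n) : convex_set C <->
  forall x y t, 0 <= t -> t <= 1 -> C x -> C y -> C (t *: x + (1 - t) *: y).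
Proof.
split=> [convC x y t t0 t1 Cx Cy|convC x y t /set_mem Cx /set_mem Cy].
  exact: (set_mem (convC x y (Itv01 t0 t1) (mem_set Cx) (mem_set Cy))).
by apply/mem_set/convC.
Qed.

(** [z] is the point of [C] nearest to [y]; a [c] beyond the hyperplane through [z] normal to
    [y - z] would allow a shorter distance. *)
Lemma nearest_point_separation (C : set 'rV[R]_n) y :
  compact C -> convex_set C -> C !=set0 -> ~ C y ->
  exists2 z, C z & forall c, C c -> dot c (y - z) < dot y (y - z).
Proof.
move=> cC convC C0 nCy.
have cf : continuous (fun z => dot (y - z) (y - z)).
  have cy : continuous (fun z => y - z).
    by move=> z; apply: (@continuousB _ _ _ (fun=> y) id); [exact: cst_continuous|].
  exact: (dot_continuous cy cy).
have [z /set_mem Cz zmin] := EVT_min_rV C0 cC (continuous_subspaceT cf).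
exists z => // c Cc.
have yz : 0 < dot (y - z) (y - z).
  rewrite lt_neqAle dot_ge0 andbT eq_sym dot_eq0 subr_eq0.
  by apply/eqP => yz; apply: nCy; rewrite yz.
suff : dot (c - z) (y - z) <= 0 by move: yz; rewrite !dotE; lra.
rewrite leNgt; apply/negP => h.
have q0 := dot_ge0 (c - z).
set p := dot (c - z) (y - z) in h *; set q := dot (c - z) (c - z) in q0 *.
(* Moving from [z] to [z + t (c - z)] changes the squared distance to [y] by [- t (2 p - t q)],
   which must not be negative. *)
have [t [t0 t1 tq]] : exists t, [/\ 0 < t, t <= 1 & t * q < 2 * p].
  exists (p / (p + q)); have pq : 0 < p + q by lra.
  split; first exact: divr_gt0.
    by rewrite ler_pdivrMr// mul1r; lra.
  by rewrite mulrAC ltr_pdivrMr//; nra.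
have := zmin (t *: c + (1 - t) *: z) _.
have -> : y - (t *: c + (1 - t) *: z) = (y - z) - t *: (c - z).
  by apply/rowP => i; rewrite !mxE; ring.
move=> /(_ (mem_set _)); have /convex_setP h' := convC.
move=> /(_ (h' _ _ _ (ltW t0) t1 Cc Cz)).
rewrite [X in _ <= X -> _](_ : _ = dot (y - z) (y - z) - t * (2 * p - t * q)); last first.
  by rewrite /p /q !dotE (dotC y c) (dotC y z) (dotC z c); ring.
have : 0 < t * (2 * p - t * q) by apply: mulr_gt0 => //; lra.
lra.
Qed.
End InnerProduct.

(** * Continuity, boundedness and closedness, for compactness arguments *)

Section Topology.
Context {R : realType} {n : nat}.
Implicit Types (x y z w xi : 'rV[R]_n).

Lemma proj_perp_continuous xi : continuous (@proj_perp R n xi).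
Proof.
move=> x; apply: (@continuousB _ _ _ id (fun x => dot x xi *: xi)); first by [].
apply: (@continuousZl _ _ _ (fun x => dot x xi)).
by apply: (@dot_continuous _ _ _ id (fun=> xi)) => y //; exact: (@cst_continuous _ _ xi).
Qed.

Lemma coord_bounded_set (A : set 'rV[R]_n) (M : R) :
  (forall x i, A x -> `|x 0 i| <= M) -> bounded_set A.
Proof.
(* [|M|] rather than [M]: the maximum defining the norm starts from 0, so the bound must be
   nonnegative. *)
move=> AM; exists `|M|; split; first exact: num_real.
move=> N MN x Ax /=; rewrite /Num.norm/= mx_normrE; apply: bigmax_le => [|[i j] _] /=.
  exact: le_trans (normr_ge0 M) (ltW MN).
rewrite ord1; apply: le_trans (AM x j Ax) _.
exact: le_trans (ler_norm M) (ltW MN).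
Qed.

Lemma dot_continuousl y : continuous (fun x : 'rV[R]_n => dot x y).
Proof.
by apply: (@dot_continuous _ _ _ id (fun=> y)) => x //; exact: (@cst_continuous _ _ y).
Qed.

Lemma dot_continuous_diag : continuous (fun x : 'rV[R]_n => dot x x).
Proof. by apply: (@dot_continuous _ _ _ id id) => x. Qed.

Lemma closed_preimage1 (f : 'rV[R]_n -> R) a :
  continuous f -> closed [set x | f x = a].
Proof.
move=> cf; apply: (@preimage_closed _ _ f [set x | x = a]); last exact: closed_eq.
by move=> x _; exact: cf.
Qed.

Lemma closed_preimage_le (f : 'rV[R]_n -> R) a :
  continuous f -> closed [set x | f x <= a].
Proof.
move=> cf; apply: (@preimage_closed _ _ f [set x | x <= a]); last exact: closed_le.
by move=> x _; exact: cf.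
Qed.

End Topology.

(** * Hyperplane reflections and their action on projections *)

Section Reflection.
Context {R : realType} {n : nat}.
Implicit Types (x y z w xi : 'rV[R]_n).

Definition reflection w x : 'rV[R]_n := x - (2 * dot x w) *: w.

Lemma reflection_is_linear w : linear (reflection w).
Proof.
by move=> a x y; apply/rowP => i; rewrite /reflection !dotE !mxE; ring.
Qed.

HB.instance Definition _ w :=
  GRing.isLinear.Build R 'rV[R]_n 'rV[R]_n *:%R (reflection w)
    (reflection_is_linear w).

Lemma dot_reflectionC w x y : dot (reflection w x) y = dot x (reflection w y).
Proof. by rewrite /reflection !dotE (dotC w y); ring. Qed.

Lemma reflectionK w : unit_sphere w -> involutive (reflection w).
Proof.
move=> /unit_sphereP w1 x; apply/rowP => i.
by rewrite /reflection !dotE w1 !mxE; ring.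
Qed.

Lemma dot_reflection w x y :
  unit_sphere w -> dot (reflection w x) (reflection w y) = dot x y.
Proof. by move=> w1; rewrite dot_reflectionC reflectionK. Qed.

Lemma perp_reflection xi w x :
  perp xi w -> perp xi x -> perp xi (reflection w x).
Proof.
by rewrite /perp/= /reflection => w0 x0; rewrite !dotE w0 x0 mulr0 subr0.
Qed.

Lemma reflection_orthogonal_on_perp xi w :
  unit_sphere w -> perp xi w -> orthogonal_on_perp xi (reflection w).
Proof.
move=> w1 pw; split; last by move=> x y _ _; exact: dot_reflection.
apply/seteqP; split => [_ [x px <-]|x px]; first exact: perp_reflection.
by exists (reflection w x); [exact: perp_reflection|exact: reflectionK].
Qed.

(* Only directions in [perp xi] see the projections, and for them the support
   function of the projection is that of the body. *)
Lemma reflection_proj_subset xi w (K L : set 'rV[R]_n) :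
  unit_sphere xi -> perp xi w ->
  compact L -> convex_set L -> L !=set0 ->
  (forall x, perp xi x ->
    exists2 l, L l & forall k, K k -> dot k (reflection w x) <= dot l x) ->
  reflection w @` (proj_perp xi @` K) `<=` proj_perp xi @` L.
Proof.
move=> xi1 pw cL /convex_setP vL [l0 Ll0] KL _ [_ [k Kk <-] <-].
apply: contrapT => nPL.
have cPL : compact (proj_perp xi @` L).
  exact/continuous_compact/cL/continuous_subspaceT/proj_perp_continuous.
have vPL : convex_set (proj_perp xi @` L).
  apply/convex_setP => _ _ t t0 t1 [x Lx <-] [y Ly <-].
  exists (t *: x + (1 - t) *: y); first exact: vL.
  by apply/rowP => i; rewrite /proj_perp !dotE !mxE; ring.
have PL0 : (proj_perp xi @` L) !=set0 by exists (proj_perp xi l0), l0.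
have [_ [z Lz <-] sep] := nearest_point_separation cPL vPL PL0 nPL.
set x := _ - proj_perp xi z in sep.
have px : perp xi x.
  have := perp_reflection pw (perp_proj_perp k xi1).
  have := perp_proj_perp z xi1.
  by rewrite /x /perp/= !dotE => -> ->; rewrite subr0.
have [l Ll] := KL x px; move=> /(_ k Kk).
have := sep _ (imageP _ Ll).
rewrite dot_proj_perp// dot_reflectionC dot_proj_perp; last exact: perp_reflection.
by move=> /lt_le_trans /[apply]; rewrite ltxx.
Qed.

Lemma reflection_proj_eq xi w (K L : set 'rV[R]_n) :
  unit_sphere xi -> unit_sphere w -> perp xi w ->
  compact K -> convex_set K -> K !=set0 ->
  compact L -> convex_set L -> L !=set0 ->
  (forall x, perp xi x ->
    exists2 l, L l & forall k, K k -> dot k (reflection w x) <= dot l x) ->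
  (forall x, perp xi x ->
    exists2 k, K k & forall l, L l -> dot l (reflection w x) <= dot k x) ->
  reflection w @` (proj_perp xi @` K) = proj_perp xi @` L.
Proof.
move=> xi1 w1 pw cK vK K0 cL vL L0 KL LK; apply/seteqP; split.
  exact: reflection_proj_subset.
move=> y Ly; exists (reflection w y); last exact: reflectionK.
by apply: (reflection_proj_subset xi1 pw cK vK K0 LK); exists y.
Qed.

End Reflection.

(** * The form Q restricted to [perp xi], and the reflection in its maximiser *)

Section Axis.
Context {R : realType} {n : nat} (i0 i1 i2 : 'I_n).
Hypotheses (i01 : i0 != i1) (i02 : i0 != i2) (i12 : i1 != i2).
Implicit Types (x y z w xi : 'rV[R]_n).

Definition saddle x : R := x 0 i1 ^+ 2 - x 0 i0 ^+ 2.

(** The third axis leaves room for two linear conditions. Q is nonnegative at such a [v], hence so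
    is its maximum on the unit sphere of [perp xi]. *)
Lemma perp_vector_coord0 xi :
  exists v, [/\ v != 0, perp xi v & v 0 i0 = 0].
Proof.
pose d i : 'rV[R]_n := delta_mx 0 i.
have dot_d i x : dot (d i) x = x 0 i by rewrite dotC dot_delta.
have [/eqP x2|x2] := eqVneq (xi 0 i2) 0.
  exists (d i2); split.
  - by apply/eqP => /rowP /(_ i2) /eqP; rewrite !mxE !eqxx oner_eq0.
  - by rewrite /perp/= dot_d; apply/eqP.
  - by rewrite mxE (negbTE i02) andbF.
(* The [i1], [i2] part of [xi] turned by a right angle. *)
exists (xi 0 i1 *: d i2 - xi 0 i2 *: d i1); split.
- apply/eqP => /rowP /(_ i1) /eqP; rewrite !mxE !eqxx (negbTE i12) !andbF/=.
  by rewrite mulr0 add0r mulr1 oppr_eq0 (negbTE x2).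
- by rewrite /perp/= !dotE !dot_d; ring.
- by rewrite !mxE (negbTE i01) (negbTE i02) !andbF/=; ring.
Qed.

Lemma saddle_continuous : continuous saddle.
Proof.
  move=> x; apply: (@continuousB _ _ _ (fun x : 'rV[R]_n => x 0 i1 ^+ 2)
  (fun x : 'rV[R]_n => x 0 i0 ^+ 2)).
    by apply: (@continuousM _ _ (fun x : 'rV[R]_n => x 0 i1)
    (fun x : 'rV[R]_n => x 0 i1)); exact: coord_continuous.
  by apply: (@continuousM _ _ (fun x : 'rV[R]_n => x 0 i0)
    (fun x : 'rV[R]_n => x 0 i0)); exact: coord_continuous.
Qed.

Lemma exists_max_saddle xi : exists w,
  [/\ unit_sphere w, perp xi w, 0 <= saddle w &
      forall x, perp xi x -> saddle x <= saddle w * dot x x].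
Proof.
have [v [v0 pv vi0]] := perp_vector_coord0 xi.
pose A := @unit_sphere R n `&` perp xi.
have normalize x : x != 0 -> perp xi x -> A ((Num.sqrt (dot x x))^-1 *: x).
  move=> x0 px; have xx : 0 < dot x x by rewrite lt_def dot_eq0 x0 dot_ge0.
  split; last by rewrite /perp/= !dotE px mulr0.
  apply/unit_sphereP; rewrite !dotE mulrA -expr2 exprVn sqr_sqrtr ?dot_ge0//.
  by rewrite mulVf// gt_eqF.
have A0 : A !=set0 by exists ((Num.sqrt (dot v v))^-1 *: v); exact: normalize.
have cA : compact A.
  apply: bounded_closed_compact.
    apply: (@coord_bounded_set _ _ _ 1) => x i [/unit_sphereP x1 _].
    rewrite -[_ <= _](ler_pXn2r (ltn0Sn 1)) ?nnegrE// expr1n real_normK ?num_real//.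
    by rewrite -x1 sqr_le_dot.
  apply: closedI; last exact/closed_preimage1/dot_continuousl.
  rewrite (_ : @unit_sphere R n = [set x | dot x x = 1]); last first.
    by apply/seteqP; split => x /unit_sphereP.
  exact/closed_preimage1/dot_continuous_diag.
have [w /set_mem [w1 pw] wmax] := EVT_max_rV A0 cA (continuous_subspaceT saddle_continuous).
have saddleZ a x : saddle (a *: x) = a ^+ 2 * saddle x by rewrite /saddle !mxE; ring.
have max x : perp xi x -> saddle x <= saddle w * dot x x.
  have [->|x0 px] := eqVneq x 0.
    by rewrite -(scale0r 0) saddleZ !dotE expr0n !mul0r mulr0.
  have xx : 0 < dot x x by rewrite lt_def dot_eq0 x0 dot_ge0.
  have := wmax _ (mem_set (normalize x x0 px)).
  by rewrite saddleZ exprVn sqr_sqrtr ?dot_ge0// mulrC ler_pdivrMr.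
exists w; split => //.
have vv : 0 < dot v v by rewrite lt_def dot_eq0 v0 dot_ge0.
rewrite -(pmulr_lge0 _ vv); apply: le_trans (max _ pv).
by rewrite /saddle vi0 expr0n/= subr0 sqr_ge0.
Qed.

(** First-order condition at the maximum: perturbing [w] to [w + t y] shows that [y] is also
    orthogonal to [w] for the polar form of Q. *)
Lemma max_saddle_critical xi w y :
  unit_sphere w -> perp xi w ->
  (forall x, perp xi x -> saddle x <= saddle w * dot x x) ->
  perp xi y -> dot y w = 0 -> w 0 i1 * y 0 i1 = w 0 i0 * y 0 i0.
Proof.
move=> /unit_sphereP w1 pw wmax py yw.
set b := w 0 i1 * y 0 i1 - w 0 i0 * y 0 i0.
pose c := saddle y - saddle w * dot y y.
have c0 : c <= 0 by rewrite /c subr_le0 wmax.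
have h t : 2 * t * b + t ^+ 2 * c <= 0.
  have : perp xi (w + t *: y) by move: pw py; rewrite /perp/= !dotE => -> ->; ring.
  move=> /wmax; rewrite !dotE w1 (dotC w) yw /c /saddle !mxE /b; lra.
suff : b ^+ 2 <= 0.
  by rewrite le_eqVlt ltNge sqr_ge0 orbF sqrf_eq0 subr_eq0 => /eqP.
have c1 : 0 < 1 - c by lra.
(* This [t] is small enough for the linear term to win; the denominator is [1 - c] since [c] may be
   0. *)
have := h (b / (1 - c)).
rewrite (_ : _ + _ = b ^+ 2 * ((2 - c) / (1 - c) ^+ 2)); last by field; rewrite gt_eqF.
by rewrite pmulr_lle0// divr_gt0 ?exprn_gt0//; lra.
Qed.

Lemma pos_congr (a b s : R) : 0 < a * b -> (0 < s * a) = (0 < s * b).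
Proof.
move=> ab; apply/idP/idP => h; rewrite ltNge; apply/negP; nra.
Qed.

(** Split [x = y + c w] with [y] orthogonal to [w]; the reflection negates [c]. By criticality Q(x)
    = Q(y) + c^2 Q(w), which is even in [c]. The coordinate products become y0^2 - c^2 p^2 and c^2
    q^2 - y1^2. *)
Lemma reflection_signs xi w x :
  unit_sphere w -> perp xi w -> 0 <= saddle w ->
  (forall x, perp xi x -> saddle x <= saddle w * dot x x) ->
  perp xi x ->
  [/\ saddle (reflection w x) = saddle x,
      saddle x < 0 -> 0 < (reflection w x) 0 i0 * x 0 i0 &
      0 < saddle x -> 0 < (reflection w x) 0 i1 * - x 0 i1].
Proof.
move=> w1 pw w0 wmax px; have w1' : dot w w = 1 by exact/unit_sphereP.
pose c := dot x w; pose y := x - c *: w.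
have py : perp xi y by rewrite /y /perp/= !dotE pw px; ring.
have yw : dot y w = 0 by rewrite /y !dotE w1' /c; ring.
have ymax := wmax y py.
have crit := max_saddle_critical w1 pw wmax py yw.
have xE i : x 0 i = y 0 i + c * w 0 i by rewrite !mxE; ring.
have rE i : reflection w x 0 i = y 0 i - c * w 0 i.
  by rewrite !mxE -/c; ring.
rewrite /saddle !rE !xE; move: ymax crit w0; rewrite /saddle.
clear xE rE py yw; clearbody y; clearbody c.
move: (dot y y) (y 0 i0) (y 0 i1) (w 0 i0) (w 0 i1) c => d y0 y1 p q c.
move=> ymax crit mu0.
have hE : (y1 + c * q) ^+ 2 - (y0 + c * p) ^+ 2
  = y1 ^+ 2 - y0 ^+ 2 + c ^+ 2 * (q ^+ 2 - p ^+ 2) by ring: crit.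
rewrite hE; split; first by ring: crit.
- move=> neg; rewrite ltNge; apply/negP => h.
  (* Interlacing in algebraic form: p^2 Q(x) = (p y1 - y0 q)^2 + (c^2 p^2 - y0^2) Q(w), nonnegative
     under [h]. The case p = 0 needs a direct argument. *)
  have e : p ^+ 2 * (y1 ^+ 2 - y0 ^+ 2) + y0 ^+ 2 * (q ^+ 2 - p ^+ 2)
    = (p * y1 - y0 * q) ^+ 2 by ring: crit.
  have e2 := sqr_ge0 (p * y1 - y0 * q).
  have h2 : (c ^+ 2 * p ^+ 2 - y0 ^+ 2) * (q ^+ 2 - p ^+ 2) >= 0.
    by apply: mulr_ge0 => //; lra.
  have [p0|p0] := eqVneq p 0.
    have : y0 ^+ 2 <= 0 by move: h; rewrite p0; lra.
    move: neg mu0; rewrite p0 expr0n/= => neg mu0 y0le.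
    by have := sqr_ge0 y1; have := mulr_ge0 (sqr_ge0 c) mu0; lra.
  have pp : 0 < p ^+ 2 by rewrite lt_def sqrf_eq0 p0 sqr_ge0.
  have : p ^+ 2 * (y1 ^+ 2 - y0 ^+ 2 + c ^+ 2 * (q ^+ 2 - p ^+ 2)) < 0.
    by rewrite pmulr_rlt0.
  lra.
- move=> pos; rewrite ltNge; apply/negP => h.
  (* Likewise q^2 Q(x) = - (q y0 - y1 p)^2 - (y1^2 - c^2 q^2) Q(w). If q = 0, then Q(w) = 0 and
     maximality makes Q(y) nonpositive. *)
  have e : q ^+ 2 * (y1 ^+ 2 - y0 ^+ 2) + y1 ^+ 2 * (q ^+ 2 - p ^+ 2)
    = - (q * y0 - y1 * p) ^+ 2 by ring: crit.
  have e2 := sqr_ge0 (q * y0 - y1 * p).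
  have h2 : (y1 ^+ 2 - c ^+ 2 * q ^+ 2) * (q ^+ 2 - p ^+ 2) >= 0.
    by apply: mulr_ge0 => //; lra.
  have [q0|q0] := eqVneq q 0.
    have mu : q ^+ 2 - p ^+ 2 = 0 by have := sqr_ge0 p; move: mu0; rewrite q0; lra.
    by move: pos ymax; rewrite mu; lra.
  have qq : 0 < q ^+ 2 by rewrite lt_def sqrf_eq0 q0 sqr_ge0.
  have : 0 < q ^+ 2 * (y1 ^+ 2 - y0 ^+ 2 + c ^+ 2 * (q ^+ 2 - p ^+ 2)).
    by rewrite pmulr_rgt0.
  lra.
Qed.

End Axis.

(** * Wulff shapes and their support points *)

Section SupportPoints.
Context {R : realType} {n : nat}.
Implicit Types (x y z : 'rV[R]_n) (h : 'rV[R]_n -> R) (i j k : 'I_n).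

(** The Wulff shape of the square root of [h]. That root is its support function once every
    direction has a point attaining the bound. *)
Definition wulff h : set 'rV[R]_n := [set y | forall x, dot y x <= Num.sqrt (h x)].

Lemma wulff_convex h : convex_set (wulff h).
Proof.
apply/convex_setP => y z t t0 t1 hy hz x.
rewrite !dotE; have := hy x; have := hz x; move: (Num.sqrt _) => a; nra.
Qed.

Lemma wulff_closed h : closed (wulff h).
Proof.
rewrite (_ : wulff h = \bigcap_x [set y | dot y x <= Num.sqrt (h x)]).
  by apply: closed_bigI => x _; exact/closed_preimage_le/dot_continuousl.
by apply/seteqP; split => [y hy x _|y hy x]; [exact: hy|exact: (hy x I)].
Qed.

Lemma wulff_compact h M : (forall x, h x <= M * dot x x) -> compact (wulff h).
Proof.
move=> hM; apply: bounded_closed_compact; last exact: wulff_closed.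
apply: (@coord_bounded_set _ _ _ (Num.sqrt M)) => y i hy.
have d1 : dot (delta_mx 0 i) (delta_mx 0 i) = 1 :> R.
  by rewrite dot_delta mxE !eqxx.
rewrite ler_norml; apply/andP; split.
  rewrite lerNl; have := hy (- delta_mx 0 i); rewrite !dotE dot_delta.
  move/le_trans; apply; apply: ler_wsqrtr; apply: le_trans (hM _) _.
  by rewrite !dotE opprK d1 mulr1.
have := hy (delta_mx 0 i); rewrite dot_delta => /le_trans; apply.
by apply: ler_wsqrtr; apply: le_trans (hM _) _; rewrite d1 mulr1.
Qed.

(** Expand [B u u >= 0] at [u = B x y *: x - B x x *: y]. A general [B] covers both [dot] and
    [form]. *)
Lemma cauchy_schwarz (B : 'rV[R]_n -> 'rV[R]_n -> R) x y :
  (forall a b x y, B (a *: x - b *: y) (a *: x - b *: y)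
    = a ^+ 2 * B x x - 2 * (a * b) * B x y + b ^+ 2 * B y y) ->
  (forall x, 0 <= B x x) -> 0 < B x x -> B x y <= Num.sqrt (B x x) * Num.sqrt (B y y).
Proof.
move=> hB B0 x0; rewrite -sqrtrM ?B0//.
apply: le_trans (ler_norm _) _; rewrite -sqrtr_sqr; apply: ler_wsqrtr.
rewrite -subr_ge0 -(pmulr_rge0 _ x0).
have := B0 (B x y *: x - B x x *: y); rewrite hB; congr (0 <= _); ring.
Qed.

(* [e = 0] gives the ball of radius [sqrt 2], [e = 1] an ellipsoid. *)
Definition form e j k x y : R :=
  2 * dot x y + e * (x 0 j * y 0 j - x 0 k * y 0 k).

Lemma form_ge e j k x : 0 <= e <= 1 -> dot x x <= form e j k x x.
Proof.
move=> e01; rewrite /form.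
have := sqr_le_dot x k; have := sqr_ge0 (x 0 j); have := sqr_ge0 (x 0 k); nra.
Qed.

(** [z] is the gradient at [x] of the square root of the form: the boundary point of the ellipsoid
    with outer normal [x]. *)
Lemma form_support_point e j k x : 0 <= e <= 1 -> x != 0 ->
  exists z, [/\ forall y, dot z y = form e j k x y / Num.sqrt (form e j k x x),
    forall y, dot z y <= Num.sqrt (form e j k y y) &
    dot z x = Num.sqrt (form e j k x x)].
Proof.
move=> e01 x0; pose B := form e j k.
have xx : 0 < dot x x by rewrite lt_def dot_eq0 x0 dot_ge0.
have Bxx : 0 < B x x by apply: lt_le_trans xx (form_ge _ _ _ e01).
have sB : 0 < Num.sqrt (B x x) by rewrite sqrtr_gt0.
pose z := (Num.sqrt (B x x))^-1 *:
  (2 *: x + e *: (x 0 j *: delta_mx 0 j - x 0 k *: delta_mx 0 k)).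
have zE y : dot z y = B x y / Num.sqrt (B x x).
  by rewrite /z /B /form !dotE ![dot (delta_mx _ _) _]dotC !dot_delta mulrC.
exists z; split => // [y|].
  rewrite zE ler_pdivrMr// mulrC; apply: cauchy_schwarz => // [a b u v|u].
    by rewrite /B /form !dotE !mxE (dotC v u); ring.
  exact: le_trans (dot_ge0 _) (form_ge _ _ _ e01).
rewrite zE; apply: (mulIf (lt0r_neq0 sB)).
by rewrite divfK ?gt_eqF// -expr2 sqr_sqrtr// ltW.
Qed.

Lemma ball_support_point h x i : (forall y, 2 * dot y y <= h y) ->
  exists2 z, wulff h z & dot z x = Num.sqrt (2 * dot x x).
Proof.
move=> h2; have [->|x0] := eqVneq x 0.
  have d0 y : dot 0 y = 0 by rewrite -(scale0r 0) dotZl mul0r.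
  exists 0; last by rewrite d0 mulr0 sqrtr0.
  by move=> y; rewrite d0 sqrtr_ge0.
have form0 y : form 0 i i y y = 2 * dot y y by rewrite /form mul0r addr0.
have e01 : 0 <= (0 : R) <= 1 by rewrite lexx ler01.
have [z [_ zle zx]] := form_support_point i i e01 x0.
exists z; last by rewrite zx form0.
by move=> y; apply: le_trans (zle y) _; rewrite form0 ler_wsqrtr.
Qed.

(** The support point of the full ellipsoid serves; the issue is that it also obeys the weaker ball
    bound assumed on the opposite half-space. *)
Lemma bump_support_point h x j k s : j != k ->
  (forall y, 2 * dot y y <= h y) ->
  (forall y, 0 < s * y 0 j -> 2 * dot y y + (y 0 j ^+ 2 - y 0 k ^+ 2) <= h y) ->
  0 < s * x 0 j ->
  exists2 z, wulff h z &
    dot z x = Num.sqrt (2 * dot x x + (x 0 j ^+ 2 - x 0 k ^+ 2)).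
Proof.
move=> jk h2 hj xj.
have x0 : x != 0 by apply: contraTneq xj => ->; rewrite mxE mulr0 ltxx.
have form1 y : form 1 j k y y = 2 * dot y y + (y 0 j ^+ 2 - y 0 k ^+ 2).
  by rewrite /form mul1r !expr2.
have e01 : 0 <= (1 : R) <= 1 by rewrite lexx ler01.
have [z [zE zle zx]] := form_support_point j k e01 x0.
exists z; last by rewrite zx form1.
move=> y; have [yj|yj] := ltP 0 (s * y 0 j).
  by apply: le_trans (zle y) _; rewrite form1 ler_wsqrtr// hj.
(* On the far side of the hyperplane [x_j = 0], removing the [j]-th coordinate
   of [y] increases the pairing with [z], and there the ellipsoid lies inside
   the ball. *)
pose y' := y - y 0 j *: delta_mx 0 j.
have yy' : dot z y <= dot z y'.
  rewrite !zE; apply: ler_wpM2r; first by rewrite invr_ge0 sqrtr_ge0.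
  rewrite /form /y' !dotE dot_delta !mxE !eqxx eq_sym (negbTE jk)/=.
  have : x 0 j * y 0 j <= 0 by nra.
  lra.
apply: le_trans yy' (le_trans (zle y') (ler_wsqrtr _)).
apply: le_trans (h2 y); rewrite form1 /y' !dotE (dotC (delta_mx _ _) y) !dot_delta.
rewrite !mxE !eqxx eq_sym (negbTE jk)/=.
have := sqr_ge0 (y 0 j); have := sqr_ge0 (y 0 k); nra.
Qed.

End SupportPoints.

(** * The two bodies, K = [body 1 1] and L = [body 1 (-1)] *)

Section Bodies.
Context {R : realType} {n : nat} (i0 i1 i2 : 'I_n).
Hypotheses (i01 : i0 != i1) (i02 : i0 != i2) (i12 : i1 != i2).
Implicit Types (x y z w xi : 'rV[R]_n) (s t : R).

(** The bump on one half-cone around the axis of [p]; the sign of [s] chooses which of the two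
    opposite halves. *)
Definition cap s (p q : R) : R :=
  if (q ^+ 2 < p ^+ 2) && (0 < s * p) then p ^+ 2 - q ^+ 2 else 0.

(* Square of the support function of the convex hull of the ball of radius
   [sqrt 2] and of two half-ellipsoids, cut by the sign conditions. *)
Definition sq_support s t x : R :=
  2 * dot x x + cap s (x 0 i0) (x 0 i1) + cap t (x 0 i1) (x 0 i0).

Definition body s t := wulff (sq_support s t).

Lemma cap_ge0 s p q : 0 <= cap s p q.
Proof. by rewrite /cap; case: ifP => // /andP[/ltW]; rewrite subr_ge0. Qed.

Lemma cap_ge s p q : 0 < s * p -> p ^+ 2 - q ^+ 2 <= cap s p q.
Proof. by rewrite /cap => ->; rewrite andbT; case: ltP => // ?; rewrite subr_le0. Qed.

Lemma cap_le s p q : cap s p q <= p ^+ 2.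
Proof.
by rewrite /cap; case: ifP => _; rewrite ?sqr_ge0// lerBlDr lerDl sqr_ge0.
Qed.

Lemma cap0 s q : cap s 0 q = 0.
Proof. by rewrite /cap mulr0 ltxx andbF. Qed.

Lemma cap10 s : cap s 1 0 = if 0 < s then 1 else 0.
Proof. by rewrite /cap mulr1 expr1n expr0n ltr01 subr0. Qed.

Lemma sq_support_ge s t x : 2 * dot x x <= sq_support s t x.
Proof. by rewrite /sq_support -addrA lerDl addr_ge0 ?cap_ge0. Qed.

Lemma sq_support_le s t x : sq_support s t x <= 4 * dot x x.
Proof.
rewrite /sq_support; have := cap_le s (x 0 i0) (x 0 i1).
have := cap_le t (x 0 i1) (x 0 i0).
have := sqr_le_dot x i0; have := sqr_le_dot x i1; lra.
Qed.

Lemma body_compact s t : compact (body s t).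
Proof. exact/wulff_compact/sq_support_le. Qed.

(** Makes [sq_support] the true squared support function. The two caps are never active together, so
    [x] sees one half-ellipsoid or the ball. *)
Lemma body_support_point s t x :
  exists2 z, body s t z & dot z x = Num.sqrt (sq_support s t x).
Proof.
have [/andP[lt1 s1]|n1] := boolP ((x 0 i1 ^+ 2 < x 0 i0 ^+ 2) && (0 < s * x 0 i0)).
  have [|y|y yp||z zb zx] := @bump_support_point _ _ (sq_support s t) x i0 i1 s.
  - by [].
  - exact: sq_support_ge.
  - by rewrite /sq_support -addrA lerD2l; apply: ler_wpDr; [exact: cap_ge0|exact: cap_ge].
  - by [].
  - exists z => //; rewrite zx /sq_support /cap lt1 s1/=.
    by rewrite (ltNge (_ ^+ 2)) (ltW lt1)/= addr0.
have [/andP[lt2 s2]|n2] := boolP ((x 0 i0 ^+ 2 < x 0 i1 ^+ 2) && (0 < t * x 0 i1)).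
  have [|y|y yp||z zb zx] := @bump_support_point _ _ (sq_support s t) x i1 i0 t.
  - by rewrite eq_sym.
  - exact: sq_support_ge.
  - by rewrite /sq_support -addrA lerD2l; apply: ler_wpDl; [exact: cap_ge0|exact: cap_ge].
  - by [].
  - exists z => //; rewrite zx /sq_support /cap (negbTE n1) lt2 s2/=.
    by rewrite addr0.
have [z zb zx] := ball_support_point x i0 (sq_support_ge s t).
by exists z => //; rewrite zx /sq_support /cap (negbTE n1) (negbTE n2) !addr0.
Qed.

Lemma body_convex_body s t : convex_body (body s t).
Proof.
split; [exact: body_compact|exact: wulff_convex|].
(* The open unit ball lies in the body, by Cauchy-Schwarz and [sq_support_ge]. *)
exists 0; rewrite /interior/=.
have o : open [set y : 'rV[R]_n | dot y y < 1].
  apply: (@open_comp _ _ (fun y => dot y y) [set r | r < 1]); last exact: open_lt.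
  by move=> y _; exact: dot_continuous_diag.
have : nbhs (0 : 'rV[R]_n) [set y : 'rV[R]_n | dot y y < 1].
  apply: open_nbhs_nbhs; split => //=.
  by rewrite -(scale0r 0) dotZl mul0r ltr01.
apply: filterS => y /= y1 x.
apply: le_trans (ler_wsqrtr (sq_support_ge s t x)).
have [->|y0] := eqVneq y 0.
  by rewrite -(scale0r 0) dotZl mul0r sqrtr_ge0.
have yy : 0 < dot y y by rewrite lt_def dot_eq0 y0 dot_ge0.
have := @cauchy_schwarz _ _ dot y x.
move=> /(_ _ (@dot_ge0 _ _) yy) /le_trans; apply; last first.
  rewrite -sqrtrM ?dot_ge0//; apply: ler_wsqrtr.
  by apply: ler_wpM2r; [exact: dot_ge0|lra].
by move=> a b u v; rewrite !dotE (dotC v u); ring.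
Qed.

(** The first cap lives where Q < 0 and keeps its sign; the second lives where Q > 0, and its flip
    turns [t] into [- t]. *)
Lemma sq_support_reflection xi w s t x :
  unit_sphere w -> perp xi w -> 0 <= saddle i0 i1 w ->
  (forall x, perp xi x -> saddle i0 i1 x <= saddle i0 i1 w * dot x x) ->
  perp xi x -> sq_support s t (reflection w x) = sq_support s (- t) x.
Proof.
move=> w1 pw w0 wmax px.
have [hE neg pos] := reflection_signs w1 pw w0 wmax px.
rewrite /sq_support dot_reflection//; congr (_ + _ + _).
  rewrite /cap -!(subr_lt0 (_ ^+ 2)) -/(saddle i0 i1 x) -/(saddle i0 i1 (reflection w x)) hE.
  case: ltP => //= /neg/pos_congr ->; case: ifP => // _.
  by rewrite -[LHS]opprB -[RHS]opprB; congr (- _).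
rewrite /cap -!(subr_gt0 (_ ^+ 2)) -/(saddle i0 i1 x) -/(saddle i0 i1 (reflection w x)) hE.
by case: ltP => //= /pos/pos_congr ->; rewrite mulrN mulNr.
Qed.

Lemma body_projections xi : unit_sphere xi ->
  exists phi : {linear 'rV[R]_n -> 'rV[R]_n}, orthogonal_on_perp xi phi /\
    phi @` (proj_perp xi @` body 1 1) = proj_perp xi @` body 1 (-1).
Proof.
move=> xi1; have [w [w1 pw w0 wmax]] := exists_max_saddle i01 i02 i12 xi.
exists (reflection w); split; first exact: reflection_orthogonal_on_perp.
have body0 s t : body s t !=set0 by have [z] := body_support_point s t 0; exists z.
(* Used with [t = 1] for one inclusion and [t = -1] for the other. *)
have supp s t x : perp xi x ->
    exists2 l, body s (- t) l &
      forall k, body s t k -> dot k (reflection w x) <= dot l x.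
  move=> px; have [l lb lx] := body_support_point s (- t) x.
  exists l => // k kb; rewrite lx -(sq_support_reflection s t w1 pw w0 wmax px).
  exact: kb.
apply: reflection_proj_eq => //.
- exact: body_compact.
- exact: wulff_convex.
- exact: body_compact.
- exact: wulff_convex.
- by move=> x; exact: supp.
- by move=> x px; have := supp 1 (-1) x px; rewrite opprK.
Qed.

(** Along the [i1] axis the squared support is 3 for K and 2 for L. *)
Lemma body_neq : body 1 1 <> body 1 (-1).
Proof.
move=> e; pose x : 'rV[R]_n := delta_mx 0 i1.
have [z] := body_support_point 1 1 x; rewrite e => /(_ x) zx zE; move: zx.
have x1 : x 0 i1 = 1 by rewrite mxE !eqxx.
have x0 : x 0 i0 = 0 by rewrite mxE (negbTE i01) andbF.
have xx : dot x x = 1 by rewrite dot_delta.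
rewrite zE /sq_support xx x0 x1 !cap0 !cap10 ltr01 ltr0N1.
by rewrite ler_psqrt ?nnegrE//; lra.
Qed.

(** Along the [i0] axis the squared support is 3 for K and 2 for -L, since L has its bump on the
    positive side. *)
Lemma body_neq_opp : body 1 1 <> [set - x | x in body 1 (-1)].
Proof.
move=> e; pose x : 'rV[R]_n := delta_mx 0 i0.
have [z] := body_support_point 1 1 x; rewrite e => -[y /(_ (- x)) yx <-].
rewrite dotNl -dotNr => zE; move: yx; rewrite {}zE.
have x1 : x 0 i1 = 0 by rewrite mxE eq_sym (negbTE i01) andbF.
have x0 : x 0 i0 = 1 by rewrite mxE !eqxx.
have xx : dot x x = 1 by rewrite dot_delta.
have xN i : (- x) 0 i = - x 0 i by rewrite !mxE.
rewrite /sq_support !dotE !xN xx x0 x1 oppr0 !cap0 cap10 ltr01.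
rewrite /cap mul1r ltr0N1 !andbF/=.
by rewrite ler_psqrt ?nnegrE//; lra.
Qed.

End Bodies.

Theorem theorem1p4 (R : realType) (n : nat) (hn : (3 <= n)%N) :
  exists K L : set 'rV[R]_n,
    [/\ convex_body K, convex_body L, K <> L, K <> [set - x | x in L] &
      forall xi : 'rV[R]_n, unit_sphere xi ->
        exists phi : {linear 'rV[R]_n -> 'rV[R]_n},
          orthogonal_on_perp xi phi /\
          phi @` (proj_perp xi @` K) = proj_perp xi @` L].
Proof.
(* With [n] in the form [m.+3], the indices 0, 1, 2 are valid and distinct. *)
case: n hn => [|[|[|m]]]// _.
pose i0 : 'I_m.+3 := inord 0; pose i1 : 'I_m.+3 := inord 1.
pose i2 : 'I_m.+3 := inord 2.
have i01 : i0 != i1 by rewrite -val_eqE /= !inordK.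
have i02 : i0 != i2 by rewrite -val_eqE /= !inordK.
have i12 : i1 != i2 by rewrite -val_eqE /= !inordK.
exists (body i0 i1 1 1), (body i0 i1 1 (-1)); split.
- exact: body_convex_body.
- exact: body_convex_body.
- exact: body_neq.
- exact: body_neq_opp.
- by move=> xi; exact: (body_projections i01 i02 i12).
Qed.
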